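(* Let $q\in\{1,\dots,n-1\}$. Suppose that $\{\sigma_1,\dots,\sigma_k\}-\{\varepsilon_1,\dots,\varepsilon_{n-k}\}$ satisfies condition $(N_a)$, and that $c_q+d_q=n-q$, $c_q\ge1$ and $d_q\ge1$. If either $\sigma_k=q+c_q-1$ or $\varepsilon_{n-k}=q+d_q-1$, then: - if $n-q-c_q$ is even, there is no $M\in\mathbb{R}$ such that $v_s^q[M]$ is strongly negative on $I\times I$; - if $n-q-c_q$ is odd, there is no $M\in\mathbb{R}$ such that $v_s^q[M]$ is strongly positive on $I\times I$.
   Context: Let $n\ge 2$, $I=[a,b]$, $M\in\mathbb{R}$, $T_n[M]u=u^{(n)}+Mu$, $k\in\{1,\dots,n-1\}$, and let $0\le\sigma_1<\dots<\sigma_k\le n-1$ and $0\le\varepsilon_1<\dots<\varepsilon_{n-k}\le n-1$ be integers. For sets $A,B\subset\{0,\dots,n-1\}$ let $X_A^B=\{u\in C^n(I): u^{(i)}(a)=0\ \forall i\in A,\ u^{(j)}(b)=0\ \forall j\in B\}$. Condition $(N_a)$: $\#\{j:\sigma_j<h\}+\#\{j:\varepsilon_j<h\}\ge h$ for all $h\in\{1,\dots,n-1\}$. $g_M(t,s)$ denotes the Green's function of $T_n[M]$ in $X_{\{\sigma_1,\dots,\sigma_k\}}^{\{\varepsilon_1,\dots,\varepsilon_{n-k}\}}$ (any assertion about $g_M$ for a given $M$ includes that it exists), and $v_s^q[M](t)=\frac{\partial^q}{\partial t^q}g_M(t,s)$. For $q\in\{1,\dots,n-1\}$: $c_q=\#\{i:\sigma_i\ge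 q\}$ and $d_q=\#\{i:\varepsilon_i\ge q\}$. Let $\mu_1^q<\dots<\mu_k^q$ be the increasing enumeration of $\{\sigma_i-q:\sigma_i\ge q\}\cup\{\sigma_i-q+n:\sigma_i<q\}$ and $\rho_1^q<\dots<\rho_{n-k}^q$ the increasing enumeration of $\{\varepsilon_i-q:\varepsilon_i\ge q\}\cup\{\varepsilon_i-q+n:\varepsilon_i<q\}$. Put $\alpha^q=\min(\{0,\dots,n-1\}\setminus\{\mu_1^q,\dots,\mu_k^q\})$ and $\beta^q=\min(\{0,\dots,n-1\}\setminus\{\rho_1^q,\dots,\rho_{n-k}^q\})$. $v_s^q[M]$ is strongly positive (strongly negative) on $I\times I$ if: $v_s^q[M](t)>0$ ($<0$) for a.e. $(t,s)\in(a,b)\times(a,b)$; $(v_s^q[M])^{(\alpha^q)}(a)>0$ ($<0$) for a.e. $s\in(a,b)$; and $(-1)^{\beta^q}(v_s^q[M])^{(\beta^q)}(b)>0$ ($<0$) for a.e. $s\in(a,b)$. *)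

(* Defs.v *)
From HB Require Import structures.
From mathcomp Require Import all_boot all_order all_algebra.
From mathcomp Require Import all_classical all_reals all_analysis.

Set Implicit Arguments.
Unset Strict Implicit.
Unset Printing Implicit Defensive.

Import Order.TTheory GRing.Theory Num.Theory.
Import numFieldNormedType.Exports.

Local Open Scope classical_set_scope.
Local Open Scope ring_scope.

(* Functions on [a, b] are represented by total functions R -> R.  Derivatives
   are taken within a set A: on A = `[a, b] this is the usual derivative inside
   and the one-sided derivative at a and b, and it does not depend on the
   values outside [a, b]. *)
Section DerivativeWithin.
Context {R : realType}.
Implicit Types (A : set R) (f : R -> R) (x : R).

Definition quotient_from f x : R -> R := fun y => (f y - f x) / (y - x).

Definition derivable_within A f x : Prop :=
  cvg (quotient_from f x @ within A x^').

Definition derive_within A f x : R :=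
  lim (quotient_from f x @ within A x^').

Definition deriven_within A (i : nat) f : R -> R := iter i (derive_within A) f.

End DerivativeWithin.

Section Problem.
Context {R : realType}.
Variables (n : nat) (a b : R).
Local Notation I := `[a, b]%classic.
Implicit Types (A B sigma eps : seq nat) (M : R) (u : R -> R) (g : R -> R -> R).

Definition T_op M u : R -> R := fun t => deriven_within I n u t + M * u t.

Definition Cn u : Prop :=
  (forall i t, (i < n)%N -> I t -> derivable_within I (deriven_within I i u) t)
  /\ {within I, continuous (deriven_within I n u)}.

Definition boundary_conditions A B u : Prop :=
  (forall i, i \in A -> deriven_within I i u a = 0) /\
  (forall j, j \in B -> deriven_within I j u b = 0).

Definition X_space A B : set (R -> R) :=
  [set u | Cn u /\ boundary_conditions A B u].

Definition nonresonant M A B : Prop :=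
  forall u, X_space A B u -> (forall t, I t -> T_op M u t = 0) ->
    forall t, I t -> u t = 0.

Definition dt g (i : nat) (t s : R) : R := deriven_within I i (g ^~ s) t.

Definition triangle_below : set (R * R) := [set z | a <= z.2 < z.1 /\ z.1 <= b].
Definition triangle_above : set (R * R) := [set z | a <= z.1 < z.2 /\ z.2 <= b].

(* The classical axioms of the Green's function of T_op M in X_space A B.  The
   lateral limits of the derivative of order n-1 at a diagonal point are taken
   jointly in (t, s), from t > s and from t < s; n is meant to be at least 2. *)
Record green_function M A B g : Prop := GreenFunction {
  green_nonresonant : nonresonant M A B ;
  green_derivable : forall i t s, (i.+2 < n)%N -> I t -> I s ->
    derivable_within I (fun t' => dt g i t' s) t ;
  green_continuous : forall i, (i.+2 <= n)%N ->
    {within I `*` I, continuous (fun z : R * R => dt g i z.1 z.2)} ;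
  green_derivable_off : forall i t s, (i < n)%N -> I t -> I s -> t != s ->
    derivable_within I (fun t' => dt g i t' s) t ;
  green_continuous_off : forall i, (i <= n)%N ->
    {within triangle_below, continuous (fun z : R * R => dt g i z.1 z.2)} /\
    {within triangle_above, continuous (fun z : R * R => dt g i z.1 z.2)} ;
  green_jump : forall t, a < t < b -> exists lb la : R,
    [/\ dt g n.-1 z.1 z.2 @[z --> within triangle_below (nbhs (t, t))] --> lb,
        dt g n.-1 z.1 z.2 @[z --> within triangle_above (nbhs (t, t))] --> la
      & lb - la = 1] ;
  green_equation : forall t s, I t -> a < s < b -> t != s ->
    T_op M (g ^~ s) t = 0 ;
  green_boundary : forall s, a < s < b -> boundary_conditions A B (g ^~ s)
}.

Definition cond_Na sigma eps : Prop :=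
  forall h, (1 <= h <= n - 1)%N ->
    (h <= count (fun x => x < h)%N sigma + count (fun x => x < h)%N eps)%N.

Definition count_ge (q : nat) (A : seq nat) : nat := count (fun x => q <= x)%N A.

(* The increasing enumerations mu^q (A = sigma) and rho^q (A = eps). *)
Definition shifted (q : nat) (A : seq nat) : seq nat :=
  sort leq [seq (if q <= x then x - q else x + n - q)%N | x <- A].

(* alpha^q (A = sigma) and beta^q (A = eps).  The default value n of the
   minimum is irrelevant as soon as A has fewer than n elements. *)
Definition first_gap (q : nat) (A : seq nat) : nat :=
  \big[minn/n]_(i < n | (i : nat) \notin shifted q A) i.

Definition strongly_positive sigma eps (q : nat) g : Prop :=
  [/\ {ae (lebesgue_measure \x lebesgue_measure)%E, forall z : R * R,
        a < z.1 < b -> a < z.2 < b -> 0 < dt g q z.1 z.2},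
      {ae lebesgue_measure, forall s : R, a < s < b ->
        0 < deriven_within I (first_gap q sigma) (fun t => dt g q t s) a}
    & {ae lebesgue_measure, forall s : R, a < s < b ->
        0 < (-1) ^+ first_gap q eps *
            deriven_within I (first_gap q eps) (fun t => dt g q t s) b}].

Definition strongly_negative sigma eps (q : nat) g : Prop :=
  [/\ {ae (lebesgue_measure \x lebesgue_measure)%E, forall z : R * R,
        a < z.1 < b -> a < z.2 < b -> dt g q z.1 z.2 < 0},
      {ae lebesgue_measure, forall s : R, a < s < b ->
        deriven_within I (first_gap q sigma) (fun t => dt g q t s) a < 0}
    & {ae lebesgue_measure, forall s : R, a < s < b ->
        (-1) ^+ first_gap q eps *
        deriven_within I (first_gap q eps) (fun t => dt g q t s) b < 0}].

End Problem.

(* Main.v *)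
(* Fix [s] and let [y] be the vector of the [t]-derivatives of order [< n] of
   [g(., s)] at an endpoint [e], [e'] the other endpoint, and [Phi] the solution
   of [u^(n) + M u = 0] with [Phi^(i)(0) = 0] for [i < n - 1] and
   [Phi^(n-1)(0) = 1].  With [z = 1] if [e = a] and [z = -1] if [e = b], the
   function [g(., s)] coincides between [s] and [e'] with the solution whose
   initial vector at [e] is [y + z (Phi^(i)(e - s))_i].  This vector has [i]-th
   coordinate [z Phi^(i)(e - s)] for every condition [i] at [e], and that solution
   satisfies the conditions at [e'].  As the boundary conditions are nonresonant,
   every coordinate of the vector is a combination of these [Phi^(i)(e - s)], with
   coefficients independent of [s].

   If the conditions at [e] all have order [< m], this combination is of higher
   order in [e - s] than [Phi^(m)(e - s) ~ (e - s)^(n-1-m) / (n-1-m)!], so that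
   [- z Phi^(m)(e - s)] gives the sign of the [m]-th derivative of [g(., s)] at
   [e] for [s] near [e].  The hypothesis on the last condition says that this
   applies to [m = q + alpha^q] at [a] or to [m = q + beta^q] at [b], and the
   resulting sign on a nonempty interval of values of [s] contradicts the
   corresponding almost everywhere condition. *)
Require Import Defs.
From HB Require Import structures.
From mathcomp Require Import all_boot all_order all_algebra.
From mathcomp Require Import all_classical all_reals all_analysis.
From mathcomp Require Import zify lra ring.

Set Implicit Arguments.
Unset Strict Implicit.
Unset Printing Implicit Defensive.

Import Order.TTheory GRing.Theory Num.Theory.
Import numFieldNormedType.Exports.

Local Open Scope classical_set_scope.
Local Open Scope ring_scope.

(** * The fundamental solution as a power series *)

Section FundamentalSolution.
Context {R : realType}.
Variables (n : nat) (M : R).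
Hypothesis n_gt0 : (0 < n)%N.

(** The derivative of order [i] at 0 of the fundamental solution: the equation multiplies it by
    [- M] each time [i] grows by [n]. *)
Definition fundamental_coeff (i : nat) : R :=
  if (i %% n == n.-1)%N then (- M) ^+ (i %/ n) else 0.

(* [fundamental j] is the derivative of order [j] of the solution of
   [u^(n) + M u = 0] with [u^(i)(0) = 0] for [i < n - 1] and [u^(n-1)(0) = 1]. *)
Definition fundamental (j : nat) (x : R) : R :=
  limn (pseries (fun i => fundamental_coeff (i + j) / i`!%:R) x).

(** As [1 + |M|] is at least 1, the exponent [i %/ n] can be raised to [i]; this gives domination by
    an exponential series. *)
Lemma fundamental_coeff_le i : `|fundamental_coeff i| <= (1 + `|M|) ^+ i.
Proof.
have M1 : 1 <= 1 + `|M| by rewrite lerDl.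
rewrite /fundamental_coeff; case: ifP => _; last first.
  by rewrite normr0 exprn_ge0// addr_ge0.
rewrite normrX normrN; apply: le_trans (_ : (1 + `|M|) ^+ (i %/ n) <= _).
  by rewrite lerXn2r ?nnegrE ?addr_ge0 ?lerDr.
by rewrite ler_weXn2l// leq_div.
Qed.

Lemma is_cvg_fundamental j x :
  cvgn (pseries (fun i => fundamental_coeff (i + j) / i`!%:R) x).
Proof.
have r0 : 0 <= 1 + `|M| by rewrite addr_ge0.
apply: normed_cvg.
apply: (@series_le_cvg _ _
  (fun i => (1 + `|M|) ^+ j * exp_coeff ((1 + `|M|) * `|x|) i)) => [i|i|i|].
- exact: normr_ge0.
- by rewrite mulr_ge0 ?exprn_ge0// exp_coeff_ge0// mulr_ge0.
- rewrite /= !normrM normfV normrX normr_nat /exp_coeff/= exprMn.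
  rewrite mulrAC !mulrA -exprD ler_wpM2r ?invr_ge0// ler_wpM2r ?exprn_ge0//.
  by rewrite addnC fundamental_coeff_le.
- have -> : (fun i => (1 + `|M|) ^+ j * exp_coeff ((1 + `|M|) * `|x|) i) =
      (1 + `|M|) ^+ j *: exp_coeff ((1 + `|M|) * `|x|) by [].
  exact/is_cvg_seriesZ/is_cvg_series_exp_coeff.
Qed.

Lemma is_derive_fundamental j (x : R) :
  is_derive x (1 : R) (fundamental j) (fundamental j.+1 x).
Proof.
have diffs k : pseries_diffs (fun i => fundamental_coeff (i + k) / i`!%:R) =
    (fun i => fundamental_coeff (i + k.+1) / i`!%:R).
  apply/funext => i; rewrite /pseries_diffs addSnnS factS natrM invfM.
  by rewrite mulrCA mulVKf// pnatr_eq0.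
rewrite /fundamental -(diffs j).
apply: (@pseries_snd_diffs _ _ (`|x| + 1)); rewrite ?diffs.
- exact: is_cvg_fundamental.
- exact: is_cvg_fundamental.
- exact: is_cvg_fundamental.
- by rewrite [ltRHS]ger0_norm ?addr_ge0// ltrDl.
Qed.

Lemma fundamental_period j x : fundamental (n + j) x = - M * fundamental j x.
Proof.
rewrite /fundamental -[RHS](lim_seriesZ _ (@is_cvg_fundamental j x)).
congr (limn (series _)); apply/funext => i.
change (fundamental_coeff (i + (n + j)) / i`!%:R * x ^+ i =
  - M * (fundamental_coeff (i + j) / i`!%:R * x ^+ i)).
rewrite !mulrA addnCA; congr (_ * _ * _).
rewrite /fundamental_coeff modnDl divnDl ?dvdnn// divnn n_gt0.
by case: ifP; rewrite ?mulr0// add1n exprS.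
Qed.

Lemma fundamental0 j : (j < n)%N -> fundamental j 0 = (j == n.-1)%:R.
Proof.
move=> jn; rewrite /fundamental.
apply: (@cvg_lim R) => //; rewrite -(cvg_shiftn 1) /=.
apply: cvg_near_cst; near=> m; rewrite /pseries /series/= addn1 big_nat_recl//.
rewrite big1_seq ?addr0; last by move=> i _; rewrite expr0n mulr0.
rewrite expr0 mulr1 add0n fact0 divr1 /fundamental_coeff modn_small// divn_small//.
by case: eqP.
Unshelve. all: by end_near.
Qed.

(** The orders [n - 1 - i + j] with [i, j < n], which occur in [transport], go up to [2n - 2]. *)
Lemma fundamental0_small j : (j < n + n.-1)%N ->
  fundamental j 0 = (j == n.-1)%:R.
Proof.
have [jn _|nj jnn] := ltnP j n; first exact: fundamental0.
rewrite -(subnKC nj) fundamental_period.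
have jn1 : (j - n < n.-1)%N by rewrite ltn_subLR.
rewrite fundamental0 ?(leq_trans jn1) ?leq_pred// (ltn_eqF jn1) mulr0.
by rewrite subnKC// gtn_eqF// prednK.
Qed.

End FundamentalSolution.

(** * Transport of a solution from one point to another *)

Section Transport.
Context {R : realType}.
Variables (n : nat) (M : R).
Hypothesis n_gt0 : (0 < n)%N.
Local Notation F := (fundamental n M).

(* When the [y i] are the successive derivatives of a solution of
   [u^(n) + M u = 0] around [t], this is the value at [e] of the [j]-th
   derivative of that solution, so it does not depend on [t]. *)
Definition transport (y : nat -> R -> R) (j : nat) (e t : R) : R :=
  \sum_(i < n) y i t * F (n.-1 - i + j) (e - t).

(** The product rule makes the derivative telescope, and its two extreme terms cancel by the
    equation for [y] and the one for [F]. *)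
Lemma is_derive_transport y j (e t : R) :
  (forall i, (i < n)%N -> is_derive t (1 : R) (y i) (y i.+1 t)) ->
  y n t = - M * y 0%N t ->
  is_derive t (1 : R) (transport y j e) 0.
Proof.
move=> dy yn.
have dF k : is_derive t (1 : R) (fun t => F k (e - t)) (- F k.+1 (e - t)).
  have dFe := is_derive_fundamental n M k (e - t).
  have dB : is_derive t (1 : R) (fun t => e - t) (- 1).
    have := is_deriveB (is_derive_cst e t (1 : R)) (is_derive_id t (1 : R)).
    by rewrite sub0r.
  have := @is_derive1_comp _ (F k) (fun t => e - t) t _ _ dFe dB.
  by rewrite mulrN1.
pose dh i := y i t * - F (n.-1 - i + j).+1 (e - t) +
  F (n.-1 - i + j) (e - t) * y i.+1 t.
have D : is_derive t (1 : R) (transport y j e) (\sum_(i < n) dh i).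
  have -> : transport y j e =
      \sum_(i < n) (y i * (fun t => F (n.-1 - i + j) (e - t))).
    by apply/funext => x; rewrite fct_sumE.
  apply: is_derive_sum => i; have := dy i (ltn_ord i); have := dF (n.-1 - i + j)%N.
  by move=> ? ?; exact: is_deriveM.
apply: is_derive_eq D _.
pose T i := F (n - i + j) (e - t) * y i t.
rewrite (eq_bigr (fun i : 'I_n => T i.+1 - T i)); last first.
  move=> i _; rewrite /dh /T.
  have -> : ((n.-1 - i + j).+1 = n - i + j)%N by have := ltn_ord i; lia.
  have -> : (n.-1 - i + j = n - i.+1 + j)%N by lia.
  by ring.
rewrite -(big_mkord xpredT (fun i => T i.+1 - T i)) telescope_sumr//.
rewrite /T subnn subn0 add0n yn fundamental_period//.
by rewrite mulrCA !mulrA subrr.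
Qed.

Lemma transport_diag y j e : (j < n)%N -> transport y j e e = y j e.
Proof.
move=> jn; rewrite /transport subrr (bigD1 (Ordinal jn))//= big1 ?addr0.
  have -> : (n.-1 - j + j = n.-1)%N by lia.
  by rewrite (fundamental0_small M n_gt0) ?eqxx ?mulr1//; lia.
move=> i; rewrite -val_eqE/= => ij; have iltn := ltn_ord i.
have ne : (n.-1 - i + j == n.-1)%N = false by lia.
have lt : (n.-1 - i + j < n + n.-1)%N by lia.
by rewrite (fundamental0_small M n_gt0 lt) ne mulr0.
Qed.

(** The addition formula for [F]: the base point can be moved from [x] to [x + z], where the
    transport is trivial. *)
Lemma transport_fundamental j (x z : R) : (j < n)%N ->
  transport F j (x + z) x = F j (x + z).
Proof.
move=> jn; rewrite -(transport_diag F (x + z) jn).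
apply: is_derive_0_is_cst => t; apply: is_derive_transport => [i _|].
  exact: is_derive_fundamental.
by have := fundamental_period M n_gt0 0 t; rewrite addn0.
Qed.

End Transport.

(** * Sign of a function near a zero of order [p] *)

Section SignNearZero.
Context {R : realType}.

Lemma MVT_from0 (f df : R -> R) (h : R) :
  h != 0 -> (forall x : R, is_derive x (1 : R) f (df x)) ->
  exists2 c, 0 < c < 1 & f h - f 0 = df (c * h) * h.
Proof.
move=> h0 dfx.
have cf (u v : R) : {within `[u, v], continuous f}.
  apply/continuous_subspaceT => x.
  exact/differentiable_continuous/derivable1_diffP.
have [hneg|hpos|/esym/eqP] := ltrgtP h 0; last by rewrite eq_sym (negPf h0).
- have [x] := MVT hneg (fun x _ => dfx x) (cf _ _).
  rewrite in_itv/= => /andP[hx x0] E; exists (x / h).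
    by rewrite nmulr_lgt0 ?invr_lt0// x0 ltr_ndivrMr// mul1r.
  by rewrite mulfVK// -opprB E sub0r mulrN opprK.
- have [x] := MVT hpos (fun x _ => dfx x) (cf _ _).
  rewrite in_itv/= => /andP[x0 hx] E; exists (x / h).
    by rewrite divr_gt0//= ltr_pdivrMr// mul1r.
  by rewrite mulfVK// E subr0.
Qed.

(** Induction on [p]: [G 0 h = h * G 1 (c * h)] with [0 < c < 1], so [c * h] has the sign of [h],
    and the extra factor [h ^+ 2] is positive. *)
Lemma sign_near0 p (G : nat -> R -> R) :
  (forall r (x : R), is_derive x (1 : R) (G r) (G r.+1 x)) ->
  (forall r, (r < p)%N -> G r 0 = 0) -> 0 < G p 0 ->
  exists2 d : R, 0 < d &
    forall h : R, h != 0 -> `|h| < d -> 0 < h ^+ p * G 0%N h.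
Proof.
elim: p G => [|p IH] G dG G0 Gp.
  have cG : G 0%N x @[x --> (0 : R)] --> G 0%N 0.
    exact/differentiable_continuous/derivable1_diffP.
  have /nbhs_ballP[d /= d0 Hd] : \forall x \near (0 : R), 0 < G 0%N x.
    exact: cvgr_gt cG _ Gp.
  exists d => // h _ hd; rewrite mul1r; apply: Hd.
  by rewrite /ball/= sub0r normrN.
have [|d d0 Hd] := IH (fun r => G r.+1) _ _ Gp.
  by move=> r rp; exact: G0.
exists d => // h h0 hd.
have [c /andP[c0 c1] E] := MVT_from0 h0 (dG 0%N).
have ch : 0 < (c * h) ^+ p * G 1%N (c * h).
  apply: Hd; first by rewrite mulf_neq0// gt_eqF.
  rewrite normrM gtr0_norm//; apply: le_lt_trans hd.
  by rewrite ler_piMl// ltW.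
move: E; rewrite G0// subr0 => ->.
move: ch; rewrite exprMn -mulrA pmulr_rgt0 ?exprn_gt0// => ch.
have -> : h ^+ p.+1 * (G 1%N (c * h) * h) = h ^+ 2 * (h ^+ p * G 1%N (c * h)).
  by rewrite exprS; ring.
by rewrite mulr_gt0// exprn_even_gt0.
Qed.

End SignNearZero.

(** * Linear algebra of boundary conditions *)

Section BoundaryFunctionals.
Context {K : fieldType}.

(* The [n] linear forms given by the coordinates in [A] and the rows [D j], [j] in
   [B], are jointly injective, hence span all linear forms. *)
Lemma coordinate_from_boundary (n m : nat) (A B : seq nat)
    (D : nat -> nat -> K) :
  (size A + size B)%N = n -> (m < n)%N -> {in A, forall i, (i < n)%N} ->
  (forall v : nat -> K, {in A, forall i, v i = 0} ->
    {in B, forall j, \sum_(i < n) v i * D j i = 0} ->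
    forall i, (i < n)%N -> v i = 0) ->
  exists l : 'I_n -> K, forall v : nat -> K,
    {in B, forall j, \sum_(i < n) v i * D j i = 0} ->
    v m = \sum_(r < n | (r < size A)%N) l r * v (nth 0%N A r).
Proof.
move=> sAB mn An inj.
(* The columns of [N] are the given forms, so a row times [N] lists their values. *)
pose N : 'M[K]_n := \matrix_(i, r) if (r < size A)%N
  then ((i : nat) == nth 0%N A r)%:R else D (nth 0%N B (r - size A)) i.
have NE (v : nat -> K) (r : 'I_n) : ((\row_(i < n) v i) *m N) 0 r =
    if (r < size A)%N then v (nth 0%N A r)
    else \sum_(i < n) v i * D (nth 0%N B (r - size A)) i.
  rewrite mxE; case: ifPn => rA; last first.
    by apply: eq_bigr => i _; rewrite !mxE (negPf rA).
  have rn : (nth 0%N A r < n)%N by apply: An; exact: mem_nth.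
  rewrite (bigD1 (Ordinal rn))//= big1 ?addr0; first by rewrite !mxE rA eqxx mulr1.
  by move=> i /negPf; rewrite -val_eqE/= !mxE rA => ->; rewrite mulr0.
have uN : N \in unitmx.
  rewrite -row_free_unit; apply: inj_row_free => v vN0.
  pose w i := if insub i is Some o then v 0 o else 0.
  have wE (i : 'I_n) : w i = v 0 i by rewrite /w valK.
  have vE : v = \row_(i < n) w i by apply/rowP => i; rewrite mxE wE.
  apply/rowP => i; rewrite mxE -wE; apply: inj => //.
    move=> k kA; have kn : (index k A < n)%N.
      by rewrite -sAB ltn_addr// index_mem.
    by have := NE w (Ordinal kn); rewrite -vE vN0 mxE /= index_mem kA nth_index//.
  move=> k kB; have kn : (size A + index k B < n)%N.
    by rewrite -sAB ltn_add2l index_mem.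
  have := NE w (Ordinal kn); rewrite -vE vN0 mxE/= ltnNge leq_addr/= addKn.
  by rewrite nth_index//.
(* Column [m] of the inverse recovers [v m] from the values of the forms, of which those coming from
   [B] vanish. *)
exists (fun r => invmx N r (Ordinal mn)) => v vB.
have := mulmxK uN (\row_(i < n) v i) => /rowP/(_ (Ordinal mn)).
rewrite [RHS]mxE/= => <-; rewrite mxE [RHS]big_mkcond/=; apply: eq_bigr => r _.
rewrite NE; case: ifPn => [|rA]; first by rewrite mulrC.
rewrite vB ?mul0r// mem_nth// ltn_subLR ?sAB// leqNgt//.
Qed.

End BoundaryFunctionals.

(** * Derivatives within a compact interval *)

Section DerivativeWithinInterval.
Context {R : realType}.
Variables (a b : R).
Hypothesis ab : a < b.
Local Notation I := `[a, b]%classic.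

Lemma within_itv_dnbhs_proper (t : R) : I t -> ProperFilter (within I t^').
Proof.
rewrite /= in_itv/= => /andP[ta tb].
apply: Build_ProperFilter_ex => P; rewrite /within/= /dnbhs /within/=.
move=> /nbhs_ballP[e /= e0 eP].
have [tltb|blet] := ltP t b.
- pose y := t + Num.min (e / 2) (b - t); exists y.
  have m0 : 0 < Num.min (e / 2) (b - t) by rewrite lt_min divr_gt0//= subr_gt0.
  apply: eP => /=.
  + rewrite /ball/= /y opprD addNKr normrN gtr0_norm// gt_min ltr_pdivrMr//.
    by rewrite ltr_pMr// ltr1n.
  + by rewrite /y gt_eqF// ltrDl.
  + rewrite in_itv/= /y -lerBrDl ge_min lexx orbT andbT.
    by rewrite (le_trans ta)// lerDl ltW.
- have alt : a < t by apply: lt_le_trans blet.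
  pose y := t - Num.min (e / 2) (t - a); exists y.
  have m0 : 0 < Num.min (e / 2) (t - a) by rewrite lt_min divr_gt0//= subr_gt0.
  apply: eP => /=.
  + rewrite /ball/= /y opprB addrC subrK gtr0_norm// gt_min ltr_pdivrMr//.
    by rewrite ltr_pMr// ltr1n.
  + by rewrite /y lt_eqF// ltrBlDr ltrDl.
  + rewrite in_itv/= /y lerBrDl -lerBrDr ge_min lexx orbT/=.
    by rewrite lerBlDr (le_trans tb)// lerDl ltW.
Qed.

(** Giving the slope the value [l] at [t] turns a limit over the punctured neighbourhood into one
    over the full neighbourhood. *)
Lemma caratheodory_within (f : R -> R) (t l : R) :
  quotient_from f t @ within I t^' --> l ->
  exists2 g : R -> R, forall y, f y = f t + g y * (y - t) &
    g @ within I (nbhs t) --> l.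
Proof.
move=> fl; exists (fun y => if y == t then l else quotient_from f t y).
  move=> y; case: eqP => [->|/eqP yt]; first by rewrite subrr mulr0 addr0.
  by rewrite mulfVK ?subr_eq0// addrC subrK.
move=> P Pl.
have fP : \forall y \near t, y != t -> I y -> P (quotient_from f t y) := fl P Pl.
change (\forall y \near t, I y -> P (if y == t then l else quotient_from f t y)).
apply: filterS fP => y fP Iy; case: eqP => [_|/eqP yt]; last exact: fP.
exact: nbhs_singleton.
Qed.

Lemma cvg_within_derivable (f : R -> R) (t : R) :
  derivable_within I f t -> f @ within I (nbhs t) --> f t.
Proof.
move=> /caratheodory_within[g fE gl].
have : (fun y => f t + g y * (y - t)) @ within I (nbhs t) -->
    f t + derive_within I f t * (t - t).
  apply: cvgD; first exact: cvg_cst.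
  apply: cvgM; first exact: gl.
  by apply: cvgB; [exact: cvg_within|exact: cvg_cst].
rewrite subrr mulr0 addr0; apply: cvg_trans; apply: near_eq_cvg.
by apply: nearW => y; rewrite -fE.
Qed.

Lemma interior_itv_oo (t : R) : a < t < b -> I^° t.
Proof.
move=> tab; suff : `]a, b[%classic `<=` I^° by apply; rewrite /= in_itv.
by rewrite -open_subsetE; [exact: subset_itvW|exact: interval_open].
Qed.

Lemma is_derive_within (f : R -> R) (t : R) : a < t < b ->
  derivable_within I f t -> is_derive t (1 : R) f (derive_within I f t).
Proof.
move=> tab /caratheodory_within[g fE gl]; apply/is_derive1_caratheodory.
have It : I^° t by exact: interior_itv_oo.
rewrite within_interior// in gl.
exists (fun y => if y == t then derive_within I f t else g y); split.
- move=> y; rewrite {1}fE addrC addKr; case: eqP => // ->.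
  by rewrite subrr !mulr0.
- apply/continuous_withinNx; rewrite eqxx.
  have : g @ t^' --> derive_within I f t.
    by apply: cvg_trans gl; apply: cvg_app; exact: cvg_within.
  apply: cvg_trans; apply: near_eq_cvg; rewrite near_withinE; near=> y.
  by move=> /negPf ->.
- by rewrite eqxx.
Unshelve. all: by end_near. Qed.

Lemma derive_within_eq (f g : R -> R) (t l : R) :
  (forall x, I x -> f x = g x) -> I t -> is_derive t (1 : R) g l ->
  derivable_within I f t /\ derive_within I f t = l.
Proof.
move=> fg It /is_derive1_caratheodory[h [gE ch <-]].
have F := within_itv_dnbhs_proper It.
suff ql : quotient_from f t @ within I t^' --> h t.
  by split; [apply/cvg_ex; exists (h t)|apply: cvg_lim].
move=> P Ph.
have hP : \forall y \near t, P (h y) := ch P Ph.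
change (\forall y \near t, y != t -> I y -> P (quotient_from f t y)).
apply: filterS hP => y + yt Iy.
by rewrite /quotient_from fg// fg// gE mulfK// subr_eq0.
Qed.

(** For a function that extends smoothly to the whole line, this replaces derivatives within [I] by
    ordinary ones, endpoints included. *)
Lemma deriven_within_chain (f : R -> R) (U : nat -> R -> R) :
  (forall t, I t -> f t = U 0%N t) ->
  (forall i (t : R), is_derive t (1 : R) (U i) (U i.+1 t)) ->
  forall i t, I t -> deriven_within I i f t = U i t /\
    derivable_within I (deriven_within I i f) t.
Proof.
move=> fU dU.
have H i t : I t -> deriven_within I i f t = U i t.
  elim: i t => [|i IH] t It; first exact: fU.
  by rewrite /deriven_within iterS; have [] := derive_within_eq IH It (dU i t).
move=> i t It; split; first exact: H.
by have [] := derive_within_eq (H i) It (dU i t).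
Qed.

End DerivativeWithinInterval.

(** * Solutions with prescribed initial vector *)

Section Solutions.
Context {R : realType}.
Variables (n : nat) (M a b : R).
Hypotheses (n_gt0 : (0 < n)%N) (ab : a < b).
Local Notation F := (fundamental n M).
Local Notation I := `[a, b]%classic.

(* The [j]-th derivative of the solution of [u^(n) + M u = 0] whose derivatives
   of order [i < n] at [e] are the [v i]. *)
Definition solution (v : nat -> R) (e : R) (j : nat) (x : R) : R :=
  transport n M (fun i _ => v i) j x e.

Lemma is_derive_solution v e j (x : R) :
  is_derive x (1 : R) (solution v e j) (solution v e j.+1 x).
Proof.
have dF k : is_derive x (1 : R) (fun x => F k (x - e)) (F k.+1 (x - e)).
  have dFe := is_derive_fundamental n M k (x - e).
  have dB : is_derive x (1 : R) (fun x => x - e) 1.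
    have := is_deriveB (is_derive_id x (1 : R)) (is_derive_cst e x (1 : R)).
    by rewrite subr0.
  have := @is_derive1_comp _ (F k) (fun x => x - e) x _ _ dFe dB.
  by rewrite mulr1.
have -> : solution v e j =
    \sum_(i < n) (v i \*: (fun x => F (n.-1 - i + j) (x - e))).
  by apply/funext => y; rewrite fct_sumE.
apply: is_derive_sum => i; rewrite addnS.
by have ? := dF (n.-1 - i + j)%N; exact: is_deriveZ.
Qed.

Lemma solution_init v e j : (j < n)%N -> solution v e j e = v j.
Proof. by move=> jn; rewrite /solution transport_diag. Qed.

Lemma solution_period v e x : solution v e n x = - M * solution v e 0 x.
Proof.
rewrite /solution /transport mulr_sumr; apply: eq_bigr => i _.
by rewrite addnC fundamental_period// addn0 mulrCA.
Qed.

(** Turns nonresonance into the joint injectivity of the boundary forms on initial vectors. *)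
Lemma nonresonant_solution (A B : seq nat) (e : R) (v : nat -> R) :
  nonresonant n a b M A B -> I e ->
  {in A, forall i, solution v e i a = 0} ->
  {in B, forall j, solution v e j b = 0} ->
  forall i, (i < n)%N -> v i = 0.
Proof.
move=> nr Ie vA vB i iltn.
have [Ia Ib] : I a /\ I b by rewrite /= !in_itv/= !lexx ltW.
have D := deriven_within_chain ab (fun t _ => erefl)
  (fun j t => is_derive_solution v e j t).
have [Di _] := D i e Ie.
have u0 : forall t, I t -> solution v e 0 t = 0.
  apply: nr; last first.
    move=> t It; rewrite /T_op; have [-> _] := D n t It.
    by rewrite solution_period mulNr addNr.
  split; first split.
  - by move=> j t _ It; have [] := D j t It.
  - apply: (@subspace_eq_continuous _ _ _ (solution v e n)).
      by move=> t; rewrite inE => It; have [] := D n t It.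
    apply: continuous_subspaceT => t.
    have ? := is_derive_solution v e n t.
    exact/differentiable_continuous/derivable1_diffP.
  - split=> j jS.
    + by have [-> _] := D j a Ia; exact: vA.
    + by have [-> _] := D j b Ib; exact: vB.
rewrite -(solution_init v e iltn) -Di.
by have [] := deriven_within_chain ab u0 (fun _ t => is_derive_cst 0 t 1) i Ie.
Qed.

End Solutions.

(** * Jump of the transported Green's function across the diagonal *)

Section GreenTransport.
Context {R : realType}.
Variables (n : nat) (M a b : R) (A B : seq nat) (g : R -> R -> R).
Hypotheses (n_gt1 : (1 < n)%N) (ab : a < b) (hg : green_function n a b M A B g).
Variable s : R.
Hypothesis sab : a < s < b.
Local Notation F := (fundamental n M).
Local Notation I := `[a, b]%classic.
Local Notation y := (fun i t => dt a b g i t s).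

Let n_gt0 : (0 < n)%N := ltnW n_gt1.

(** Passes from the limits jointly in [(t, s)] to limits in [t] alone. *)
Lemma cvg_green_slice (T : set (R * R)) (G : set_system R) (i : nat) (l : R) :
  Filter G -> G --> s -> (\forall t \near G, T (t, s)) ->
  dt a b g i z.1 z.2 @[z --> within T (nbhs (s, s))] --> l ->
  y i t @[t --> G] --> l.
Proof.
move=> FG Gs GT gl P Pl.
have Gss : (fun t => (t, s)) @ G --> (s, s).
  move=> Q [[U V] /= [Us Vs] UVQ]; apply: filterS (Gs _ Us) => t Ut.
  by apply: UVQ; split => //; exact: nbhs_singleton.
have H : \forall z \near (s, s), T z -> P (dt a b g i z.1 z.2) := gl P Pl.
have GH : \forall t \near G, T (t, s) -> P (y i t) := Gss _ H.
by apply: filterS2 GT GH => t Tt; apply.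
Qed.

Lemma cvg_transport (G : set_system R) (u : nat -> R -> R) (l : 'I_n -> R)
    (j : nat) (e t : R) : Filter G -> G --> t ->
  (forall i : 'I_n, u i x @[x --> G] --> l i) ->
  transport n M u j e x @[x --> G] -->
    \sum_(i < n) l i * F (n.-1 - i + j) (e - t).
Proof.
move=> FG Gt ul; apply: cvg_big => [|i _]; first exact: add_continuous.
apply: cvgM; first exact: ul.
apply: (@continuous_cvg _ _ _ _ _ (fun x => e - x)); last first.
  by apply: cvgB; [exact: cvg_cst|exact: Gt].
have ? := is_derive_fundamental n M (n.-1 - i + j) (e - t).
exact/differentiable_continuous/derivable1_diffP.
Qed.

(** The derivative vanishes inside [[c, d]], which avoids [s]; at [c] and [d], possibly endpoints of
    [I], continuity within [[c, d]] is enough for the mean value theorem. *)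
Lemma transport_green_constant (c d e : R) (j : nat) :
  a <= c -> c <= d -> d <= b -> (s < c) || (d < s) ->
  transport n M y j e c = transport n M y j e d.
Proof.
move=> ac cd db scd; apply/eqP; rewrite eq_sym -subr_eq0; apply/eqP.
have Is : I s by case/andP: sab => ? ?; rewrite /= in_itv/= !ltW.
have cdI : `[c, d]%classic `<=` I.
  by move=> t /=; rewrite !in_itv/= => /andP[ct td]; rewrite (le_trans ac ct) (le_trans td).
have ts t : `[c, d]%classic t -> t != s.
  rewrite /= in_itv/= => /andP[ct td]; case/orP: scd => h.
    by rewrite gt_eqF// (lt_le_trans h).
  by rewrite lt_eqF// (le_lt_trans _ h).
have [||r _ ->] := @MVT_segment _ (transport n M y j e) (cst 0) c d cd; last 1 first.
- by rewrite mul0r.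
- move=> t; rewrite in_itv/= => /andP[ct td].
  have tcd : `[c, d]%classic t by rewrite /= in_itv/= !ltW.
  have tab : a < t < b by rewrite (le_lt_trans ac)// (lt_le_trans td).
  apply: is_derive_transport => // [i iltn|].
    exact: (is_derive_within tab
      (green_derivable_off hg iltn (cdI _ tcd) Is (ts _ tcd))).
  apply/eqP; rewrite mulNr -addr_eq0; apply/eqP.
  by apply: (green_equation hg) => //; [exact: cdI|exact: ts].
- apply/subspace_continuousP => t tcd.
  apply: cvg_transport; first exact: cvg_within.
  move=> i; have := cvg_within_derivable
    (green_derivable_off hg (ltn_ord i) (cdI _ tcd) Is (ts _ tcd)).
  by apply: cvg_trans; apply: cvg_app; exact: within_subset.
Qed.

(** The transport is constant on each side of [s]. As [t] tends to [s], only the derivative of order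
    [n - 1] jumps, by 1, and its coefficient tends to [F j (e - s)]. *)
Lemma transport_green_jump (e : R) (j : nat) :
  transport n M y j e b - transport n M y j e a = F j (e - s).
Proof.
have [as_ sb] := andP sab.
have [lb [la [hb ha lba]]] := green_jump hg sab.
have Iss : (I `*` I) (s, s) by split; rewrite /= in_itv/= !ltW.
have cont i : (i.+1 < n)%N -> y i t @[t --> s] --> y i s.
  move=> iltn; have := green_continuous hg iltn => /subspace_continuousP/(_ _ Iss).
  apply: cvg_green_slice; first exact: cvg_id.
  near=> t; split; last by case: Iss.
  rewrite /= in_itv/= ; apply/andP; split; apply: ltW; near: t.
    exact: lt_nbhsr.
  exact: lt_nbhsl.
(* The transport from [s] when the derivative of order [n - 1] is given the lateral value [l]. *)
pose S l := \sum_(i < n) (if (i == n.-1 :> nat) then l else y i s) *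
  F (n.-1 - i + j) (e - s).
have lim (G : set_system R) (l w : R) : ProperFilter G -> G --> s ->
    y n.-1 t @[t --> G] --> l ->
    (\forall t \near G, transport n M y j e t = w) -> w = S l.
  move=> PG Gs Gl Gw; apply: (@cvg_unique _ _ (transport n M y j e @ G)).
  - exact: norm_hausdorff.
  - move=> P Pw.
    change (\forall t \near G, P (transport n M y j e t)).
    by apply: filterS Gw => t ->; exact: nbhs_singleton.
  - apply: cvg_transport => // i.
    case: eqP => [->//|/eqP ni].
    have iltn : (i.+1 < n)%N by have := ltn_ord i; lia.
    by apply: cvg_trans (cont _ iltn); exact: cvg_app.
have hlb : y n.-1 t @[t --> s^'+] --> lb.
  apply: cvg_green_slice hb; first exact: cvg_within.
  near=> t; rewrite /triangle_below/= (ltW as_)/=; split.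
    by near: t; exact: nbhs_right_gt.
  by near: t; exact: nbhs_right_le.
have hla : y n.-1 t @[t --> s^'-] --> la.
  apply: cvg_green_slice ha; first exact: cvg_within.
  near=> t; rewrite /triangle_above/=; split; last exact: ltW.
  apply/andP; split.
    by near: t; exact: nbhs_left_ge.
  by near: t; exact: nbhs_left_lt.
have -> : transport n M y j e b = S lb.
  apply: (lim s^'+) hlb _; first exact: cvg_within.
  near=> t; apply: transport_green_constant => //.
  + by rewrite ltW// (lt_trans as_)//; near: t; exact: nbhs_right_gt.
  + by near: t; exact: nbhs_right_le.
  + by apply/orP; left; near: t; exact: nbhs_right_gt.
have -> : transport n M y j e a = S la.
  apply: (lim s^'-) hla _; first exact: cvg_within.
  near=> t; apply/esym; apply: transport_green_constant => //.
  + by near: t; exact: nbhs_left_ge.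
  + by rewrite ltW// (lt_trans _ sb)//; near: t; exact: nbhs_left_lt.
  + by apply/orP; right; near: t; exact: nbhs_left_lt.
have nn : (n.-1 < n)%N by rewrite prednK.
rewrite /S -sumrB (bigD1 (Ordinal nn))//= big1 ?addr0.
  by rewrite eqxx -mulrBl lba mul1r subnn add0n.
by move=> i; rewrite -val_eqE/= => /negPf ->; rewrite subrr.
Unshelve. all: by end_near. Qed.

End GreenTransport.

(** * Sign of a derivative at an endpoint, for abstract data *)

Section EndpointSign.
Context {R : realType}.
Variables (n : nat) (M : R).
Hypothesis n_gt0 : (0 < n)%N.
Local Notation F := (fundamental n M).

(* Near [e], the dominant part of [Y s m] as [s] tends to [e] is
   [- z * F m (e - s)]: solving the boundary conditions expresses the rest by
   the [F i (e - s)] with [i] in [S], which are of higher order as [i < m]. *)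
Lemma endpoint_sign (m : nat) (S S' : seq nat) (e e' z : R) (D : set R)
    (Y : R -> nat -> R) :
  (size S + size S')%N = n -> (m < n)%N ->
  {in S, forall i, (i < m)%N} -> {in S', forall j, (j < n)%N} ->
  (forall v : nat -> R, {in S, forall i, v i = 0} ->
    {in S', forall j, solution n M v e j e' = 0} ->
    forall i, (i < n)%N -> v i = 0) ->
  z * z = 1 ->
  (forall s, D s -> {in S, forall i, Y s i = 0}) ->
  (forall s, D s -> {in S', forall j,
    solution n M (Y s) e j e' + z * F j (e' - s) = 0}) ->
  exists2 d : R, 0 < d & forall s, D s -> s != e -> `|e - s| < d ->
    0 < - z * ((e - s) ^+ (n.-1 - m) * Y s m).
Proof.
move=> sS mn Sm S'n inj zz YS YS'.
have Sn : {in S, forall i, (i < n)%N}.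
  by move=> i /Sm im; exact: ltn_trans mn.
have [l lE] := @coordinate_from_boundary R n m S S'
  (fun j i => F (n.-1 - i + j) (e' - e)) sS mn Sn inj.
(* [G r] is the [r]-th derivative of [G 0], where [- z * G 0 (e - s)] will be [Y s m]. *)
pose G r h := F (m + r) h - \sum_(k < n | (k < size S)%N) l k * F (nth 0%N S k + r) h.
have YE s : D s -> Y s m = - z * G 0%N (e - s).
  move=> Ds; pose V i := Y s i + z * F i (e - s).
  have VE : V m = \sum_(k < n | (k < size S)%N) l k * V (nth 0%N S k).
    apply: lE => j jS'; rewrite -[RHS](YS' s Ds j jS').
    under eq_bigr do rewrite mulrDl -mulrA.
    rewrite big_split/= -mulr_sumr; congr (_ + _ * _).
    (* The addition formula expands [F j (e' - s)] at [e], so that [V] satisfies the conditions at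
       [e']. *)
    have := transport_fundamental M n_gt0 (e - s) (e' - e) (S'n _ jS').
    have -> : e - s + (e' - e) = e' - s by ring.
    move=> <-; apply: eq_bigr => i _; congr (_ * F _ _).
    by ring.
  have -> : Y s m = V m - z * F m (e - s) by rewrite addrK.
  rewrite VE /G addn0 mulNr mulrBr opprB mulr_sumr; congr (_ - _).
  apply: eq_bigr => k kS; rewrite /V YS ?mem_nth// add0r addn0.
  by rewrite mulrCA.
have dG r (x : R) : is_derive x (1 : R) (G r) (G r.+1 x).
  pose c (k : 'I_n) := if (k < size S)%N then l k else 0.
  have GE i h : G i h = F (m + i) h - \sum_(k < n) c k *: F (nth 0%N S k + i) h.
    rewrite /G big_mkcond/=; congr (_ - _); apply: eq_bigr => k _.
    by rewrite /c; case: ifP => // _; rewrite scale0r.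
  have -> : G r = F (m + r) - \sum_(k < n) (c k \*: F (nth 0%N S k + r)).
    by apply/funext => h; rewrite GE [RHS]/= fctE/= fct_sumE.
  rewrite GE; apply: is_deriveB.
    by rewrite addnS; exact: is_derive_fundamental.
  apply: is_derive_sum => k; rewrite addnS.
  have ? := is_derive_fundamental n M (nth 0%N S k + r) x.
  exact: is_deriveZ.
(* The entries of [S] are below [m], so their terms have order below [n - 1] and vanish at 0;
   [F (m + r)] reaches order [n - 1] exactly at [r = n - 1 - m]. *)
have G0 r : (r <= n.-1 - m)%N -> G r 0 = (r == n.-1 - m)%N%:R.
  move=> rm; rewrite /G big1 ?subr0 => [|k kS].
    rewrite (fundamental0 M); last lia.
    by congr (_ %:R); apply/eqP/eqP; lia.
  move: (nth 0%N S k) (Sm _ (mem_nth 0%N kS)) => i im.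
  rewrite (fundamental0 M); last lia.
  by rewrite (_ : (_ == _) = false) ?mulr0//; lia.
have [||d d0 Hd] := sign_near0 (p := n.-1 - m) dG.
- by move=> r rm; rewrite G0 1?ltnW// ltn_eqF.
- by rewrite G0// eqxx.
exists d => // s Ds se es; rewrite YE//.
have -> : - z * ((e - s) ^+ (n.-1 - m) * (- z * G 0%N (e - s))) =
    z * z * ((e - s) ^+ (n.-1 - m) * G 0%N (e - s)) by ring.
by rewrite zz mul1r; apply: Hd => //; rewrite subr_eq0 eq_sym.
Qed.

End EndpointSign.

(** * Sign of the Green's function's derivatives at [a] and [b] *)

Section GreenEndpointSign.
Context {R : realType}.
Variables (n : nat) (M a b : R) (A B : seq nat) (g : R -> R -> R).
Hypotheses (n_gt1 : (1 < n)%N) (ab : a < b) (hg : green_function n a b M A B g).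
Hypothesis sAB : (size A + size B)%N = n.
Hypotheses (An : {in A, forall i, (i < n)%N}) (Bn : {in B, forall i, (i < n)%N}).
Local Notation I := `[a, b]%classic.

Let n_gt0 : (0 < n)%N := ltnW n_gt1.
Let Ia : I a. Proof. by rewrite /= in_itv/= lexx ltW. Qed.
Let Ib : I b. Proof. by rewrite /= in_itv/= lexx ltW. Qed.

(** Here [z = 1]; the sign collects [- z] and that of [(a - s) ^+ (n - 1 - m)]. *)
Lemma green_sign_left m : (m < n)%N -> {in A, forall i, (i < m)%N} ->
  exists2 d : R, 0 < d & forall s, a < s < b -> s - a < d ->
    0 < (-1) ^+ (n - m) * dt a b g m a s.
Proof.
move=> mn Am.
have [||s sab i iA|s sab j jB|d d0 Hd] := @endpoint_sign R n M n_gt0 m A B a b 1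
  [set s | a < s < b] (fun s i => dt a b g i a s) sAB mn Am Bn.
- move=> v vA vB; apply: (nonresonant_solution n_gt0 ab (green_nonresonant hg) Ia) => //.
  by move=> i iA; rewrite (solution_init M n_gt0 v a (An iA)); exact: vA.
- by rewrite mulr1.
- by have [H _] := green_boundary hg sab; exact: H.
- have jump := transport_green_jump n_gt1 ab hg sab b j.
  rewrite mul1r -jump addrCA [solution _ _ _ _ _ _]/(transport n M _ j b a).
  rewrite subrr addr0 (transport_diag M n_gt0 _ _ (Bn jB)).
  by have [_ H] := green_boundary hg sab; exact: H.
exists d => // s sab sd; have [as_ sb] := andP sab.
have := Hd s sab; rewrite gt_eqF// distrC gtr0_norm ?subr_gt0// => /(_ erefl sd).
have -> : - 1 * ((a - s) ^+ (n.-1 - m) * dt a b g m a s) =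
    (s - a) ^+ (n.-1 - m) * ((-1) ^+ (n - m) * dt a b g m a s).
  have -> : (n - m = (n.-1 - m).+1)%N by lia.
  by rewrite -(opprB s a) [(- (s - a)) ^+ _]exprNn exprS; ring.
by rewrite pmulr_rgt0// exprn_gt0// subr_gt0.
Qed.

(** Here [z = -1] and [b - s > 0], so no sign remains. *)
Lemma green_sign_right m : (m < n)%N -> {in B, forall i, (i < m)%N} ->
  exists2 d : R, 0 < d & forall s, a < s < b -> b - s < d ->
    0 < dt a b g m b s.
Proof.
move=> mn Bm.
have sBA : (size B + size A)%N = n by rewrite addnC.
have [||s sab i iB|s sab j jA|d d0 Hd] := @endpoint_sign R n M n_gt0 m B A b a (-1)
  [set s | a < s < b] (fun s i => dt a b g i b s) sBA mn Bm An.
- move=> v vB vA; apply: (nonresonant_solution n_gt0 ab (green_nonresonant hg) Ib) => //.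
  by move=> i iB; rewrite (solution_init M n_gt0 v b (Bn iB)); exact: vB.
- by rewrite mulrNN mulr1.
- by have [_ H] := green_boundary hg sab; exact: H.
- have jump := transport_green_jump n_gt1 ab hg sab a j.
  rewrite mulN1r -jump opprB addrC subrK (transport_diag M n_gt0 _ _ (An jA)).
  by have [H _] := green_boundary hg sab; exact: H.
exists d => // s sab sd; have [as_ sb] := andP sab.
have := Hd s sab; rewrite lt_eqF// gtr0_norm ?subr_gt0// => /(_ erefl sd).
by rewrite opprK mul1r pmulr_rgt0// exprn_gt0// subr_gt0.
Qed.

End GreenEndpointSign.

(** * Computation of [alpha^q] and [beta^q] *)

Section FirstGap.

Lemma first_gapE (n q c : nat) (A : seq nat) : (c < n)%N ->
  (forall i, (i < c)%N -> i \in shifted n q A) -> c \notin shifted n q A ->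
  first_gap n q A = c.
Proof.
move=> cn low cA; apply/eqP; rewrite eqn_leq; apply/andP; split; last first.
  rewrite /first_gap; apply: (big_ind (fun x => c <= x)%N) => [|x y cx cy|i iA].
  - exact: ltnW.
  - by rewrite leq_min cx.
  - by rewrite leqNgt; apply: contra iA; exact: low.
rewrite /first_gap; have : Ordinal cn \in index_enum 'I_n by rewrite mem_index_enum.
elim: (index_enum 'I_n) => // o r IH; rewrite inE big_cons => /predU1P[<-|or].
  by rewrite cA geq_minl.
by case: ifP => _; [rewrite geq_min IH ?orbT|exact: IH].
Qed.

(** With [c = count_ge q A], the [c] distinct entries from [q] on lie below [q + c], hence fill
    [[q, q + c)] and shift to [0, ..., c - 1]. The smaller entries shift to at least [n - q > c]. *)
Lemma consecutive_tail (n q : nat) (A : seq nat) :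
  sorted ltn A -> (0 < count_ge q A)%N -> (q + count_ge q A < n)%N ->
  nth 0%N A (size A - 1) = (q + count_ge q A - 1)%N ->
  {in A, forall i, (i < q + count_ge q A)%N} /\
  first_gap n q A = count_ge q A.
Proof.
move=> sA c0 qcn lastA.
have Aub : {in A, forall i, (i < q + count_ge q A)%N}.
  move=> i iA; have sl : sorted leq A by apply: sub_sorted sA => x y /ltnW.
  rewrite -(nth_index 0%N iA); move: iA; rewrite -index_mem.
  move: (index i A) => k.
  change ((k < size A)%N -> (nth 0%N A k < q + count_ge q A)%N) => kA.
  have : (nth 0%N A k <= nth 0%N A (size A - 1))%N.
    have kA1 : (k <= size A - 1)%N by lia.
    have lA : (size A - 1 < size A)%N by lia.
    exact: (sorted_leq_nth leq_trans leqnn 0%N sl).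
  by rewrite lastA; lia.
split=> //; pose s := [seq i <- A | (q <= i)%N].
have [_ memA] : (size (iota q (count_ge q A)) = size s) * (iota q (count_ge q A) =i s).
  have us : uniq s by rewrite filter_uniq// (sorted_uniq ltn_trans ltnn).
  have sub : {subset s <= iota q (count_ge q A)}.
    by move=> i; rewrite mem_filter mem_iota => /andP[-> /Aub].
  have [] := uniq_min_size us sub; first by rewrite size_iota size_filter.
  by move=> e1 e2; split => // i; rewrite e2.
apply: first_gapE => [|i ic|]; first lia.
  rewrite mem_sort; apply/mapP; exists (q + i)%N; last by rewrite leq_addr addKn.
  have : (q + i)%N \in iota q (count_ge q A) by rewrite mem_iota; lia.
  by rewrite memA mem_filter => /andP[].
rewrite mem_sort; apply/mapP => -[i iA]; have := Aub i iA.
by case: ifP => ? ? ?; lia.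
Qed.

End FirstGap.

(** * From signs near an endpoint to the contradiction *)

Lemma ae_lebesgue_itv (R : realType) (c d : R) (P : R -> Prop) : c < d ->
  {ae lebesgue_measure, forall s : R, P s} -> exists2 s, c < s < d & P s.
Proof.
move=> cd aeP; apply: contrapT => noP.
have /negligibleP : (@lebesgue_measure R).-negligible `]c, d[%classic.
  apply: negligibleS aeP => s; rewrite /= in_itv/= => scd Ps.
  by apply: noP; exists s.
move=> /(_ (measurable_itv _)).
have := lebesgue_measure_itv `]c, d[%R; rewrite /= lte_fin cd => -> /eqP.
by rewrite -EFinB eqe subr_eq0 gt_eqF.
Qed.

Theorem corollary3p14 (R : realType) (n k q : nat) (a b : R)
    (sigma : k.-tuple nat) (eps : (n - k).-tuple nat) :
  (2 <= n)%N -> a < b -> (1 <= k <= n - 1)%N ->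
  sorted ltn sigma -> (forall x, x \in sigma -> (x <= n - 1)%N) ->
  sorted ltn eps -> (forall x, x \in eps -> (x <= n - 1)%N) ->
  (1 <= q <= n - 1)%N ->
  cond_Na n sigma eps ->
  (count_ge q sigma + count_ge q eps)%N = (n - q)%N ->
  (1 <= count_ge q sigma)%N -> (1 <= count_ge q eps)%N ->
  nth 0%N sigma (k - 1) = (q + count_ge q sigma - 1)%N \/
  nth 0%N eps (n - k - 1) = (q + count_ge q eps - 1)%N ->
  (~~ odd (n - q - count_ge q sigma) ->
    ~ exists (M : R) (g : R -> R -> R),
        green_function n a b M sigma eps g /\
        strongly_negative n a b sigma eps q g) /\
  (odd (n - q - count_ge q sigma) ->
    ~ exists (M : R) (g : R -> R -> R),
        green_function n a b M sigma eps g /\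
        strongly_positive n a b sigma eps q g).
Proof.
move=> n2 ab kn ssig sign seps epsn qn _ cd c1 d1 last_eq.
(* The parity in the statement is thus that of [count_ge q eps]. *)
have dE : (n - q - count_ge q sigma)%N = count_ge q eps by lia.
have sz : (size sigma + size eps)%N = n by rewrite !size_tuple; lia.
have sign' : {in sigma, forall i, (i < n)%N} by move=> i /sign; lia.
have epsn' : {in eps, forall i, (i < n)%N} by move=> i /epsn; lia.
have dtE g i s t : deriven_within `[a, b]%classic i (fun t => dt a b g q t s) t =
    dt a b g (q + i) t s by rewrite /dt /deriven_within addnC iterD.
pose sgn : R := (-1) ^+ count_ge q eps.
(* One of the two boundary conditions of strong sign contradicts the sign of
   the corresponding derivative for [s] near that endpoint. *)
suff bdry M g : green_function n a b M sigma eps g -> exists2 I : R * R,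
    a <= I.1 < I.2 /\ I.2 <= b &
    (forall s, I.1 < s < I.2 -> 0 < sgn *
      deriven_within `[a, b]%classic (first_gap n q sigma)
        (fun t => dt a b g q t s) a) \/
    (forall s, I.1 < s < I.2 -> 0 < sgn * ((-1) ^+ first_gap n q eps *
      deriven_within `[a, b]%classic (first_gap n q eps)
        (fun t => dt a b g q t s) b)).
  rewrite dE /sgn in bdry *; split=> odd_d [M [g [hg [_ sa sb]]]];
    have [[c d] /= [/andP[ac cd'] db] H] := bdry _ _ hg.
  - case: H => H.
    + have [s scd] := ae_lebesgue_itv cd' sa.
      have sab : a < s < b by lra.
      move=> /(_ sab); have := H s scd.
      by rewrite -signr_odd (negPf odd_d) mul1r; lra.
    + have [s scd] := ae_lebesgue_itv cd' sb.
      have sab : a < s < b by lra.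
      move=> /(_ sab); have := H s scd.
      by rewrite -signr_odd (negPf odd_d) mul1r; lra.
  - case: H => H.
    + have [s scd] := ae_lebesgue_itv cd' sa.
      have sab : a < s < b by lra.
      move=> /(_ sab); have := H s scd.
      by rewrite -signr_odd odd_d expr1 mulN1r; lra.
    + have [s scd] := ae_lebesgue_itv cd' sb.
      have sab : a < s < b by lra.
      move=> /(_ sab); have := H s scd.
      by rewrite -signr_odd odd_d expr1 mulN1r; lra.
move=> hg; case: last_eq => last_eq.
- have [||| sub ->] := @consecutive_tail n q sigma ssig; rewrite ?size_tuple//.
    by lia.
  have [|d d0 Hd] := green_sign_left n2 ab hg sz sign' epsn' (m := q + count_ge q sigma) _ sub.
    by lia.
  exists (a, Num.min b (a + d)).
    by rewrite /= lexx lt_min ab ltrDl d0 ge_min lexx.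
  left=> s /=; rewrite lt_min => /and3P[as_ sb sd].
  (* With [m = q + alpha^q] and [alpha^q = count_ge q sigma], the sign [(-1) ^+ (n - m)] is exactly
     [sgn]. *)
  rewrite dtE /sgn -dE -subnDA; apply: Hd; first by rewrite as_.
  by rewrite ltrBlDl.
- have [||| sub ->] := @consecutive_tail n q eps seps; rewrite ?size_tuple//.
    by lia.
  have [|d d0 Hd] := green_sign_right n2 ab hg sz sign' epsn' (m := q + count_ge q eps) _ sub.
    by lia.
  exists (Num.max a (b - d), b).
    by rewrite /= le_max lexx gt_max ab ltrBlDr ltrDl d0 /=.
  right=> s /=; rewrite gt_max => /andP[/andP[as_ sd] sb].
  (* As [beta^q = count_ge q eps], the two powers of [-1] cancel. *)
  rewrite dtE /sgn mulrA -exprD addnn -mul2n exprM sqrrN expr1n expr1n mul1r.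
  by apply: Hd; [rewrite as_|rewrite ltrBlDr -ltrBlDl].
Qed.
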